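(* Let $k$ be a kernel whose support is $S=\{\pm3^l: l\in\mathbb{N}_0\}$, let $S_+=S\cap\mathbb{N}$, and assume that $$\sum_{l\in S_+}\frac{k(3l)}{k(l)}<\infty.$$ Then the corresponding operator $\mathcal{L}$ satisfies $CD(0,d)$ for some finite $d>0$.
   Context: $\mathbb{N}=\{1,2,\dots\}$, $\mathbb{N}_0=\mathbb{N}\cup\{0\}$. A kernel is a function $k:\mathbb{Z}\to[0,\infty)$ with $k(0)=0$, $k(-j)=k(j)$ for all $j\in\mathbb{N}$, and $0<|k|_1:=\sum_{j\in\mathbb{Z}}k(j)<\infty$; its support is $\{j\in\mathbb{Z}:k(j)\ne0\}$. The associated operator is $\mathcal{L}u(x)=\sum_{j\in\mathbb{Z}}k(j)\big(u(x+j)-u(x)\big)$, $x\in\mathbb{Z}$, and the iterated carré du champ operator is given by $\Gamma_2(u)(x)=\frac14\sum_{j,l\in\mathbb{Z}}k(j)k(l)\big(u(x+j+l)-u(x+j)-u(x+l)+u(x)\big)^2\in[0,\infty]$. A function $u:\mathbb{Z}\to\mathbb{R}$ is admissible for $CD(0,d)$ at $x\in\mathbb{Z}$ if $\sum_{j\in\mathbb{Z}}k(j)|u(x+j)|<\infty$. For $d\in(0,\infty)$, $\mathcal{L}$ satisfies $CD(0,d)$ if $\Gamma_2(u)(x)\ge\frac1d\big(\mathcal{L}u(x)\big)^2$ for every $x\in\mathbb{Z}$ and every $u$ admissible at $x$. *)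

(* Defs.v *)
From HB Require Import structures.
From mathcomp Require Import all_boot all_order all_algebra.
From mathcomp Require Import all_classical all_reals.
From mathcomp Require Import ereal numfun esum.

Set Implicit Arguments.
Unset Strict Implicit.
Unset Printing Implicit Defensive.

Import Order.TTheory GRing.Theory Num.Theory.

Local Open Scope classical_set_scope.
Local Open Scope ring_scope.

Section Kernels.
Variable R : realType.
Implicit Types (k u : int -> R) (x : int) (d : R).

Definition norm1 k : \bar R := \esum_(j in [set: int]) (k j)%:E.

Record is_kernel k : Prop := IsKernel {
  kernel_ge0 : forall j : int, 0 <= k j;
  kernel_at0 : k 0 = 0;
  kernel_sym : forall j : nat, (0 < j)%N -> k (- j%:Z) = k j%:Z;
  kernel_norm1_gt0 : (0 < norm1 k)%E;
  kernel_norm1_fin : (norm1 k < +oo)%E }.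

Definition ksupport k : set int := [set j | k j != 0].

Definition ksupport_pos k : set int := ksupport k `&` [set j : int | 0 < j].

(* [esum] is only meaningful for nonnegative terms, so the sum over Z of an
   absolutely summable real family is the difference of the sums of its
   positive and negative parts. *)
Definition zsum (a : int -> R) : R :=
  fine (\esum_(j in [set: int]) (EFin \o a)^\+ j -
        \esum_(j in [set: int]) (EFin \o a)^\- j)%E.

(* When u is admissible at x and k is a kernel, the terms are absolutely
   summable, so the value below is the genuine sum; the operator is only
   used in that situation. *)
Definition Lop k u x : R := zsum (fun j => k j * (u (x + j) - u x)).

Definition Gamma2 k u x : \bar R :=
  ((4^-1)%:E * \esum_(p in [set: int * int])
     (k p.1 * k p.2 *
       (u (x + p.1 + p.2) - u (x + p.1) - u (x + p.2) + u x) ^+ 2)%:E)%E.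

Definition admissible k u x : Prop :=
  (\esum_(j in [set: int]) (k j * `|u (x + j)|)%:E < +oo)%E.

Definition CD0 k d : Prop :=
  forall x u, admissible k u x -> ((d^-1 * Lop k u x ^+ 2)%:E <= Gamma2 k u x)%E.

End Kernels.

(* Main.v *)
Require Import Defs.
From HB Require Import structures.
From mathcomp Require Import all_boot all_order all_algebra.
From mathcomp Require Import all_classical all_reals.
From mathcomp Require Import ereal numfun esum.
From mathcomp Require Import ring lra zify.

Set Implicit Arguments.
Unset Strict Implicit.
Unset Printing Implicit Defensive.

Import Order.TTheory GRing.Theory Num.Theory.

Local Open Scope classical_set_scope.
Local Open Scope ring_scope.

(** Fix x and put a(j) = u(x+j) + u(x-j) - 2 u(x). The kernel being even,
    L u(x) is the sum of k(j) a(j) over j = 1, 3, 9, ..., whereas 4 Gamma_2 is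
    the sum over all pairs (p, q) of the squares

      F(p, q) = k(p) k(q) (u(x+p+q) - u(x+p) - u(x+q) + u(x))^2.

    The pairs (j, -j) only give the l^2 quantity sum (k(j) a(j))^2, as
    F(j, -j) = (k(j) a(j))^2; this does not control an l^1 sum. What makes
    powers of 3 special is that x + 2i is reached from x in two ways with steps
    of the support, 2i = i + i = 3i - i. Subtracting the two corresponding
    second differences eliminates u(x + 2i), and adding the mirror image gives
    exactly a(3i) - a(i). So consecutive values of a are close:
    k(i) k(3i) (a(3i) - a(i))^2 is bounded by terms of Gamma_2, up to the
    bounded factor r(i) = k(3i)/k(i) in front of F(i, i) and F(-i, -i).

    Writing a(3i) = a(i) + (a(3i) - a(i)) one gets (lemma [sqr_step_le])

      (k(3i) a(3i))^2 <= r(i) w(i),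

    where w(i) ([step_energy]) is a combination of five terms F, at pairs
    that depend injectively on i; hence the sum of w is at most a constant
    times 4 Gamma_2 ([esum_step_energy_le]). By hypothesis r is summable, and
    Cauchy-Schwarz bounds the sum of k(3i) |a(3i)| over i = 1, 3, 9, ... by a
    multiple of the square root of Gamma_2. Only k(1) |a(1)| is left, which is
    the square root of F(1, -1). *)

(** * Sums of nonnegative families *)

Lemma le_esum_subset (R : realType) (T : choiceType) (P Q : set T)
    (a : T -> \bar R) :
  (forall i, 0 <= a i)%E -> P `<=` Q ->
  (\esum_(i in P) a i <= \esum_(i in Q) a i)%E.
Proof.
move=> a0 PQ; rewrite esum_mkcond [leRHS]esum_mkcond; apply: le_esum => i _.
case: ifPn => [/set_mem/PQ Qi|_]; first by rewrite mem_set.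
by case: ifP.
Qed.

Lemma le_esum_reindex (R : realType) (T T' : choiceType) (P : set T)
    (e : T -> T') (a : T' -> \bar R) :
  (forall i, 0 <= a i)%E -> injective e ->
  (\esum_(i in P) a (e i) <= \esum_(i in [set: T']) a i)%E.
Proof.
move=> a0 e_inj; rewrite -esum_image; last by move=> i j _ _ /e_inj.
exact: le_esum_subset.
Qed.

Lemma le_esum_setU1_image (R : realType) (T : choiceType) (P : set T) (x : T)
    (e : T -> T) (a : T -> \bar R) :
  (forall i, 0 <= a i)%E -> injective e -> P `<=` x |` e @` P ->
  (\esum_(i in P) a i <= a x + \esum_(i in P) a (e i))%E.
Proof.
move=> a0 e_inj Psub; rewrite (esumID [set x]); last by move=> *; exact: a0.
apply: leeD.
  by rewrite -[leRHS](@esum_set1 _ _ x)//; apply: le_esum_subset => // i [].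
rewrite -(@esum_image _ _ _ P e); last by move=> i j _ _ /e_inj.
by apply: le_esum_subset => // i [/Psub[]].
Qed.

Lemma esumZl (R : realType) (T : choiceType) (P : set T) (c : R)
    (a : T -> \bar R) : 0 <= c -> (forall i, 0 <= a i)%E ->
  (\esum_(i in P) (c%:E * a i) = c%:E * \esum_(i in P) a i)%E.
Proof.
move=> c0 a0; rewrite /esum -ereal_supZl//; last first.
  by apply/set0P; eexists; exists set0; [exact: fsets_set0|].
congr ereal_sup; rewrite image_comp; apply: eq_imagel => X _ /=.
by rewrite ge0_mule_fsumr.
Qed.

(** * The operator as a sum over positive jumps *)

Lemma esum_int_paired (R : realType) (g : int -> \bar R) :
  (forall j, 0 <= g j)%E -> g 0 = 0%E ->
  \esum_(j in [set: int]) g j =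
  (\esum_(j in [set j : int | (0 < j)%R]) (g j + g (- j)%R))%E.
Proof.
move=> g0 gz; rewrite esumD//.
rewrite (esumID [set j : int | 0 < j])//; congr (_ + _)%E.
  by rewrite setTI.
rewrite setTI (esumID [set 0])//.
rewrite esum1 ?add0e; last by move=> j [_ ->].
rewrite -(@esum_image _ _ _ _ -%R) //; last first.
  by move=> i j _ _ /oppr_inj.
congr (esum _ _); apply/seteqP; split=> [j [/= /negP jn j0]|_ [j /= j0 <-]].
  exists (- j) => /=; last by rewrite opprK.
  by move: jn j0 => /=; move/eqP; lia.
by split => /=; [apply/negP|apply/eqP]; lia.
Qed.

(** The cancellation between a(j) and a(-j) must be kept: for the operator the
    sums a(j) + a(-j) are symmetric second differences of u, which Gamma_2
    controls, whereas it does not control first differences. The bound holds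
    because the positive and negative parts, each summed over pairs, differ by
    at most the sum on the right. *)
Lemma zsum_le_paired (R : realType) (a : int -> R) : a 0 = 0 ->
  ((`|zsum a|)%:E <=
   \esum_(j in [set j : int | (0 < j)%R]) (`|a j + a (- j)|)%:E)%E.
Proof.
move=> az.
have pos0 j : (0 <= (EFin \o a)^\+ j)%E by exact: funepos_ge0.
have neg0 j : (0 <= (EFin \o a)^\- j)%E by exact: funeneg_ge0.
rewrite /zsum.
have Ep := esum_int_paired pos0 _.
have En := esum_int_paired neg0 _.
rewrite Ep; last by rewrite funeposE /= az maxxx.
rewrite En; last by rewrite funenegE /= az oppr0 maxxx.
set P := [set j : int | 0 < j].
set p := fun j => _; set n := fun j => _.
have p0 j : P j -> (0 <= p j)%E by move=> _; apply: adde_ge0.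
have n0 j : P j -> (0 <= n j)%E by move=> _; apply: adde_ge0.
set c := fun j => _.
have pn j : P j -> (p j <= n j + c j)%E /\ (n j <= p j + c j)%E.
  move=> _; rewrite /p /n /c !funeposE !funenegE /=.
  rewrite -!EFin_max -!EFinD !lee_fin.
  have maxB (y : R) : Num.max y 0 - Num.max (- y) 0 = y.
    by rewrite /Num.max oppr_lt0; case: ltgtP; lra.
  have := ler_norm (a j + a (- j)); have := ler_norm (- (a j + a (- j))).
  by rewrite normrN; have := maxB (a j); have := maxB (a (- j)); lra.
have c0 j : P j -> (0 <= c j)%E by move=> _; rewrite lee_fin.
have h1 : (esum P p <= esum P n + esum P c)%E.
  by rewrite -esumD//; apply: le_esum => j /pn[].
have h2 : (esum P n <= esum P p + esum P c)%E.
  by rewrite -esumD//; apply: le_esum => j /pn[].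
have := esum_ge0 c0; have := esum_ge0 p0; have := esum_ge0 n0.
move: h1 h2.
(* If one of the two parts is infinite, their difference is infinite as well,
   and [fine] sends it to 0. *)
case: (esum P c) => [C| |]; case: (esum P p) => [p'| |];
  case: (esum P n) => [n'| |] //=; rewrite ?normr0 ?leey //.
by rewrite -!EFinD !lee_fin => *; rewrite ler_norml; lra.
Qed.

(** * Second differences controlled by the iterated carre du champ *)

Definition gamma2_term (R : realType) (k u : int -> R) x (p : int * int) : R :=
  k p.1 * k p.2 *
    (u (x + p.1 + p.2) - u (x + p.1) - u (x + p.2) + u x) ^+ 2.

Definition sym_diff (R : realType) (u : int -> R) x j : R :=
  u (x + j) + u (x - j) - 2 * u x.

(** The part of Gamma_2 that controls the passage from i to 3i: the pair
    (i, -i) gives the value of [sym_diff] at i, the other four its increment.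
    M is to be an upper bound of k(3i)/k(i), so that M k(i)^2, the weight of
    the pairs (i, i) and (-i, -i), dominates k(i) k(3i), the weight of the
    pairs (3i, -i) and (-3i, i). *)
Definition step_energy (R : realType) (k u : int -> R) x M i : R :=
  let F := gamma2_term k u x in
  2 * M * F (i, - i) +
  8 * (M * F (i, i) + M * F (- i, - i) + F (3 * i, - i) + F (- (3 * i), i)).

Lemma gamma2_term_ge0 (R : realType) (k u : int -> R) x p :
  (forall j, 0 <= k j) -> 0 <= gamma2_term k u x p.
Proof. by move=> k0; rewrite mulr_ge0 ?sqr_ge0 ?mulr_ge0. Qed.

Lemma step_energy_ge0 (R : realType) (k u : int -> R) x M i :
  (forall j, 0 <= k j) -> 0 <= M -> 0 <= step_energy k u x M i.
Proof.
move=> k0 M0; have F0 p := gamma2_term_ge0 u x p k0.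
have FM p : 0 <= M * gamma2_term k u x p by exact: mulr_ge0.
rewrite /step_energy; move: (FM (i, - i)) (FM (i, i)) (FM (- i, - i)).
by move: (F0 (3 * i, - i)) (F0 (- (3 * i), i)); lra.
Qed.

Lemma gamma2_term_opposite (R : realType) (k u : int -> R) x j :
  k (- j) = k j -> gamma2_term k u x (j, - j) = (k j * sym_diff u x j) ^+ 2.
Proof.
move=> kN; rewrite /gamma2_term /sym_diff /= kN.
by rewrite (_ : x + j - j = x); [ring | ring].
Qed.

(** The step where powers of 3 enter: the two decompositions i + i and 3i - i
    of 2i, and their mirror images, give
    sym_diff(3i) - sym_diff(i) = (A - B) + (A' - B') with each of the four
    terms a second difference occurring in Gamma_2. *)
Lemma sqr_step_le (R : realType) (k u : int -> R) x M i :
  (forall j, k (- j) = k j) -> 0 < k i -> 0 <= k (3 * i) ->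
  k (3 * i) / k i <= M ->
  (k (3 * i) * sym_diff u x (3 * i)) ^+ 2 <=
  k (3 * i) / k i * step_energy k u x M i.
Proof.
move=> kN ki0 k3i0 rM.
rewrite /step_energy gamma2_term_opposite// /gamma2_term /sym_diff /= !kN.
have -> : x + 3 * i - i = x + i + i by ring.
have -> : x - 3 * i + i = x - i - i by ring.
set r := k (3 * i) / k i in rM *.
have r0 : 0 <= r by rewrite divr_ge0// ltW.
have -> : k (3 * i) = r * k i by rewrite divfK// gt_eqF.
move: (k i) (r) ki0 r0 rM (u x) (u (x + i)) (u (x - i))
  (u (x + i + i)) (u (x - i - i)) (u (x + 3 * i)) (u (x - 3 * i)).
clear; move=> K s K0 s0 sM z p1 q1 p2 q2 p3 q3.
set A := p2 - p1 - p1 + z; set A' := q2 - q1 - q1 + z.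
set B := p2 - p3 - q1 + z; set B' := q2 - q3 - p1 + z.
set a := p1 + q1 - 2 * z; set b := p3 + q3 - 2 * z.
(* The value p2 of u at x + 2i cancels in A - B, the value q2 at x - 2i
   cancels in A' - B'. *)
have Eb : b = a + (A - B + A' - B') by rewrite /a /b /A /B /A' /B'; ring.
have core : b ^+ 2 <= 2 * a ^+ 2 + 8 * (A ^+ 2 + A' ^+ 2 + B ^+ 2 + B' ^+ 2).
  rewrite Eb; clearbody a A A' B B'.
  rewrite -subr_ge0.
  (* (a + e)^2 <= 2 a^2 + 2 e^2, and the sum e of four terms has
     e^2 <= 4 (sum of their squares); the defects are written as squares. *)
  have -> : 2 * a ^+ 2 + 8 * (A ^+ 2 + A' ^+ 2 + B ^+ 2 + B' ^+ 2) -
      (a + (A - B + A' - B')) ^+ 2 =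
      (a - (A - B + A' - B')) ^+ 2 + 2 * ((A + B) ^+ 2 + (A - A') ^+ 2 +
      (A + B') ^+ 2 + (B + A') ^+ 2 + (B - B') ^+ 2 + (A' + B') ^+ 2) by ring.
  by rewrite addr_ge0 ?sqr_ge0// mulr_ge0// !addr_ge0// sqr_ge0.
have c0 : 0 <= s * (M - s) * K ^+ 2.
  by rewrite mulr_ge0 ?sqr_ge0// mulr_ge0// subr_ge0.
have sK : 0 <= (s * K) ^+ 2 by exact: sqr_ge0.
have h1 := ler_wpM2l sK core.
have h2 : 0 <= s * (M - s) * K ^+ 2 *
    (2 * a ^+ 2 + 8 * (A ^+ 2 + A' ^+ 2)).
  by rewrite mulr_ge0// addr_ge0// mulr_ge0 ?addr_ge0 ?sqr_ge0.
clearbody a b A A' B B'; lra.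
Qed.

(** Cauchy-Schwarz in a form that can be summed termwise: optimizing t after
    summation gives back the product of the square roots of the two sums. *)
Lemma ler_norm_amgm (R : realType) (y r w t : R) :
  0 <= r -> 0 <= w -> 0 < t -> y ^+ 2 <= r * w ->
  `|y| <= 2^-1 * t * r + 2^-1 * t^-1 * w.
Proof.
move=> r0 w0 t0 yrw.
have ti0 : 0 < t^-1 by rewrite invr_gt0.
have m0 : 0 <= 2^-1 * t * r + 2^-1 * t^-1 * w by nra.
rewrite -(ler_pXn2r (n := 2)) ?nnegrE// real_normK ?num_real//.
apply: le_trans yrw _; rewrite -subr_ge0.
have -> : (2^-1 * t * r + 2^-1 * t^-1 * w) ^+ 2 - r * w =
   (2^-1 * t * r - 2^-1 * t^-1 * w) ^+ 2 by field; rewrite gt_eqF.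
exact: sqr_ge0.
Qed.

(** Each of the five pairs in [step_energy] is an injective function of i, so
    each contributes at most the full sum over all pairs; the constant is
    the sum 2M + 8M + 8M + 8 + 8 of the coefficients. *)
Lemma esum_step_energy_le (R : realType) (k u : int -> R) x M (P : set int) :
  (forall j, 0 <= k j) -> 0 <= M ->
  (\esum_(i in P) (step_energy k u x M i)%:E <=
   (18 * M + 16)%:E *
   \esum_(p in [set: int * int]) (gamma2_term k u x p)%:E)%E.
Proof.
move=> k0 M0; set F := gamma2_term k u x.
have F0 p : (0 <= (F p)%:E)%E by rewrite lee_fin gamma2_term_ge0.
set G := \esum_(p in [set: int * int]) _.
have bnd c (e : int -> int * int) : 0 <= c -> injective e ->
    (\esum_(i in P) (c%:E * (F (e i))%:E) <= c%:E * G)%E.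
  move=> c0 ei; rewrite esumZl//; apply: lee_wpmul2l => //.
  exact: (le_esum_reindex _ F0 ei).
have t0 c p : 0 <= c -> (0 <= c%:E * (F p)%:E)%E.
  by move=> c0; rewrite mule_ge0.
have M2 : 0 <= 2 * M by lra.
have M8 : 0 <= 8 * M by lra.
have E8 : 0 <= 8 :> R by lra.
rewrite (eq_esum (b := fun i => (2 * M)%:E * (F (i, - i))%:E +
  ((8 * M)%:E * (F (i, i))%:E + ((8 * M)%:E * (F (- i, - i))%:E +
   (8%:E * (F (3 * i, - i))%:E + 8%:E * (F (- (3 * i), i))%:E))))%E); last first.
  by move=> i _; rewrite -!EFinM -!EFinD /step_energy -/F; congr _%:E; ring.
rewrite !esumD//; try by move=> i Pi; rewrite ?adde_ge0 ?t0.
have -> : ((18 * M + 16)%:E * G = (2 * M)%:E * G + ((8 * M)%:E * G +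
    ((8 * M)%:E * G + (8%:E * G + 8%:E * G))))%E.
  rewrite -!ge0_muleDl ?adde_ge0 ?lee_fin// -!EFinD.
  by congr (_%:E * _)%E; ring.
do ! apply: leeD; apply: bnd => // i j [] /=; lia.
Qed.

(** * The curvature-dimension inequality *)

(** Since each positive jump other than 1 is the triple of another one, a bound
    for the steps from i to 3i reaches all jumps. *)
Lemma ksupport_pos_tripling (R : realType) (k : int -> R) :
  ksupport k = [set j : int | exists l : nat, j = 3 ^+ l \/ j = - (3 ^+ l)] ->
  ksupport_pos k `<=` 1 |` ( *%R 3) @` ksupport_pos k.
Proof.
move=> hS j; rewrite /ksupport_pos hS => -[[l jl] j0].
have p3 m : 0 < 3 ^+ m :> int by rewrite exprn_gt0.
have {jl} -> : j = 3 ^+ l by case: jl => // jl; move: j0 (p3 l) => /=; lia.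
case: l => [|l]; first by left.
right; exists (3 ^+ l); last by rewrite exprS.
by split => //=; exists l; left.
Qed.

Lemma Lop_le_esum_sym_diff (R : realType) (k u : int -> R) x :
  k 0 = 0 -> (forall j, k (- j) = k j) ->
  ((`|Lop k u x|)%:E <=
   \esum_(j in [set j : int | (0 < j)%R]) (`|k j * sym_diff u x j|)%:E)%E.
Proof.
move=> kz kN; rewrite /Lop; apply: le_trans (zsum_le_paired _) _.
  by rewrite kz mul0r.
apply: le_esum => j _; rewrite kN /sym_diff lee_fin le_eqVlt; apply/orP; left.
by apply/eqP; congr (`|_|); ring.
Qed.

(** The bound is by any positive g above 4 Gamma_2, rather than by 4 Gamma_2
    itself, so that the parameter t = sqrt g of the termwise Cauchy-Schwarz
    inequality is positive even if Gamma_2 vanishes. *)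
Lemma sqr_Lop_le (R : realType) (k u : int -> R) x (M g : R) :
  (forall j, 0 <= k j) -> k 0 = 0 -> (forall j, k (- j) = k j) ->
  ksupport_pos k `<=` 1 |` ( *%R 3) @` ksupport_pos k ->
  (\esum_(l in ksupport_pos k) (k (3 * l) / k l)%:E <= M%:E)%E ->
  0 < g -> (\esum_(p in [set: int * int]) (gamma2_term k u x p)%:E <= g%:E)%E ->
  Lop k u x ^+ 2 <= (9 + 10 * M) ^+ 2 * g.
Proof.
move=> k0 kz kN S3 sumM g0 Gg.
set P := ksupport_pos k in S3 sumM.
have r0 l : 0 <= k (3 * l) / k l by rewrite divr_ge0.
have M0 : 0 <= M.
  by rewrite -lee_fin (le_trans _ sumM)// esum_ge0// => l _; rewrite lee_fin.
have rM l : P l -> k (3 * l) / k l <= M.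
  move=> Pl; rewrite -lee_fin; apply: le_trans sumM.
  rewrite -[leLHS](@esum_set1 _ _ l (fun i => (k (3 * i) / k i)%:E)) ?lee_fin//.
  by apply: le_esum_subset => [i|i ->]//; rewrite lee_fin.
set F := gamma2_term k u x in Gg.
have F0 p : 0 <= F p by exact: gamma2_term_ge0.
set h := Num.sqrt g.
have h0 : 0 < h by rewrite sqrtr_gt0.
have hh : h ^+ 2 = g by rewrite sqr_sqrtr// ltW.
have first : `|k 1 * sym_diff u x 1| <= h.
  rewrite -(ler_pXn2r (n := 2)) ?nnegrE ?(ltW h0)// real_normK ?num_real// hh.
  rewrite -gamma2_term_opposite// -lee_fin; apply: le_trans Gg.
  rewrite -[leLHS](@esum_set1 _ _ (1, - 1) (fun p => (F p)%:E)) ?lee_fin//.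
  by apply: le_esum_subset => [p|//]; rewrite lee_fin.
have E0 i : 0 <= step_energy k u x M i by exact: step_energy_ge0.
have next i : P i -> `|k (3 * i) * sym_diff u x (3 * i)| <=
    2^-1 * h * (k (3 * i) / k i) + 2^-1 * h^-1 * step_energy k u x M i.
  move=> Pi; apply: ler_norm_amgm => //.
  apply: sqr_step_le => //; last exact: rM.
  by case: Pi => /= ki _; rewrite lt0r ki k0.
suff LB : `|Lop k u x| <= (9 + 10 * M) * h.
  rewrite -hh -exprMn -real_normK ?num_real//.
  by rewrite ler_pXn2r ?nnegrE ?mulr_ge0// ?ltW//; lra.
rewrite -lee_fin; apply: le_trans (Lop_le_esum_sym_diff _ _ kz kN) _.
pose s j := (`|k j * sym_diff u x j|)%:E.
have s0 j : (0 <= s j)%E by rewrite lee_fin.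
have s_supp : (esum [set j : int | (0 < j)%R] s <= esum P s)%E.
  rewrite esum_mkcond [leRHS]esum_mkcond; apply: le_esum => j _.
  case: ifPn => [|_]; last by case: ifP.
  rewrite inE => j0; case: ifPn => //; rewrite notin_setE => nPj.
  have : k j = 0 by apply: contra_notP nPj => /eqP kj; split.
  by rewrite /s => kj0; rewrite kj0 mul0r normr0.
apply: le_trans s_supp _.
apply: le_trans (le_esum_setU1_image s0 _ S3) _; first by move=> i j; lia.
have hi0 : 0 <= 2^-1 * h^-1 by rewrite mulr_ge0// invr_ge0 ltW.
have h20 : 0 <= 2^-1 * h by rewrite mulr_ge0// ltW.
apply: (@le_trans _ _ (h%:E + ((2^-1 * h)%:E * M%:E +
    (2^-1 * h^-1)%:E * ((18 * M + 16)%:E * g%:E)))%E).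
  apply: leeD; first by rewrite lee_fin.
  apply: le_trans (le_esum (b := fun i => ((2^-1 * h)%:E *
    (k (3 * i) / k i)%:E + (2^-1 * h^-1)%:E *
    (step_energy k u x M i)%:E)%E) _) _.
    by move=> i /next; rewrite -!EFinM -EFinD lee_fin.
  rewrite esumD; [|by move=> i _; rewrite mule_ge0 ?lee_fin..].
  rewrite !esumZl//; [|by move=> i; rewrite lee_fin..].
  apply: leeD; apply: lee_wpmul2l => //.
  apply: le_trans (esum_step_energy_le _ _ _ k0 M0) _.
  by apply: lee_wpmul2l => //; rewrite lee_fin; lra.
(* The total is (9 + 19/2 M) h. *)
rewrite -!EFinM -!EFinD lee_fin.
have -> : 2^-1 * h^-1 * ((18 * M + 16) * g) = (9 * M + 8) * h.
  by rewrite -hh; field; rewrite gt_eqF.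
have := mulr_ge0 M0 (ltW h0); lra.
Qed.

Theorem theorem5p2 (R : realType) (k : int -> R) (hk : is_kernel k)
  (hS : ksupport k =
        [set j : int | exists l : nat, j = 3 ^+ l \/ j = - (3 ^+ l)])
  (hsum : (\esum_(l in ksupport_pos k) (k (3 * l) / k l)%:E < +oo)%E) :
  exists d : R, 0 < d /\ CD0 k d.
Proof.
have k0 := kernel_ge0 hk.
have kN j : k (- j) = k j.
  have sym := kernel_sym hk.
  case: j => [[|n]|n]; rewrite ?oppr0 ?NegzE ?opprK//; first exact: sym.
  by rewrite sym.
set M := fine (\esum_(l in ksupport_pos k) (k (3 * l) / k l)%:E)%E.
have s0 : (0 <= \esum_(l in ksupport_pos k) (k (3 * l) / k l)%:E)%E.
  by apply: esum_ge0 => l _; rewrite lee_fin divr_ge0.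
have M0 : 0 <= M by exact: fine_ge0.
have sumM : (\esum_(l in ksupport_pos k) (k (3 * l) / k l)%:E <= M%:E)%E.
  by rewrite fineK// ge0_fin_numE.
have C0 : 0 < (9 + 10 * M) ^+ 2 by rewrite exprn_gt0//; lra.
(* The factor 4 compensates the normalization 1/4 of Gamma_2. *)
exists (4 * (9 + 10 * M) ^+ 2); split; first by rewrite mulr_gt0.
move=> x u _; rewrite /Gamma2.
have bound := sqr_Lop_le k0 (kernel_at0 hk) kN (ksupport_pos_tripling hS) sumM.
have : (0 <= \esum_(p in [set: int * int]) (gamma2_term k u x p)%:E)%E.
  by apply: esum_ge0 => p _; rewrite lee_fin gamma2_term_ge0.
have {bound} := bound u x.
rewrite /gamma2_term.
case: (esum _ _) => [c| |] // bound c0; last first.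
  by rewrite gt0_muley ?leey// lte_fin.
rewrite -EFinM lee_fin invfM -mulrA ler_pM2l ?invr_gt0//.
(* For finite Gamma_2, apply the bound with g slightly above 4 Gamma_2. *)
rewrite ler_pdivrMl//; apply/ler_addgt0Pr => e e0.
have d0 : 0 < e / (9 + 10 * M) ^+ 2 by rewrite divr_gt0.
move: c0; rewrite lee_fin => c0.
have := bound (c + e / (9 + 10 * M) ^+ 2) (ltr_wpDl c0 d0).
rewrite lee_fin lerDl (ltW d0) => /(_ isT) /le_trans; apply.
by rewrite mulrDr [X in _ + X]mulrC divfK// gt_eqF.
Qed.
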